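(* Let $\mathcal{P}\subseteq\mathbb{R}^D$ have linear span equal to $\mathbb{R}^D$. An ALPV with scheduling space $\mathcal{P}$ is minimal if and only if it is reachable and observable. If two minimal ALPVs (with scheduling space $\mathcal{P}$) are input-output equivalent, then they are isomorphic.
   Context: Fix positive integers $D,m,r$, put $Q=\{1,\dots,D\}$. For a set $X$, $X^+$ denotes the set of finite non-empty sequences of elements of $X$. $\mathbb{N}$ contains $0$. For a set $\mathcal{P}\subseteq\mathbb{R}^D$ (scheduling space), a discrete-time affine LPV system (ALPV) $\Sigma=(r,m,n,\mathcal{P},\{(A_q,B_q,C_q)\}_{q=1}^D)$ consists of $n\in\mathbb{N}$ and matrices $A_q\in\mathbb{R}^{n\times n}$, $B_q\in\mathbb{R}^{n\times m}$, $C_q\in\mathbb{R}^{r\times n}$, $q\in Q$, and has dynamics $$x(t+1)=\sum_{q=1}^D (A_qx(t)+B_qu(t))p_q(t),\qquad y(t)=\sum_{q=1}^D C_qx(t)p_q(t),$$ with $p(t)=(p_1(t),\dots,p_D(t))\in\mathcal{P}$, $u(t)\in\mathbb{R}^m$. Its dimension is $\dim\Sigma=n$. Let $\mathcal{U}=\mathcal{P}\times\mathbb{R}^m$. For $x\in\mathbb{R}^n$ and $w=(p(0),u(0))\cdots(p(t),u(t))\in\mathcal{U}^+$, $x_{\Sigma,x}(w)$ and $y_{\Sigma,x}(w)$ denote the state $x(t)$ and output $y(t)$ at time $t$ when $x(0)=x$ and the scheduling values and inputs in $w$ are applied. The input-output map of $\Sigma$ is $y_\Sigma=y_{\Sigma,0}:\mathcal{U}^+\to\mathbb{R}^r$;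 $\Sigma$ is a realization of $f:\mathcal{U}^+\to\mathbb{R}^r$ if $f=y_\Sigma$. $\Sigma_1,\Sigma_2$ are input-output equivalent if $y_{\Sigma_1}=y_{\Sigma_2}$. $\Sigma$ is reachable if $\{x_{\Sigma,0}(w): w\in\mathcal{U}^+\}$ spans $\mathbb{R}^n$; observable if $y_{\Sigma,x_1}=y_{\Sigma,x_2}$ implies $x_1=x_2$; minimal if $\dim\Sigma\le\dim\hat\Sigma$ for every ALPV $\hat\Sigma$ (with the same $r,m,\mathcal{P}$) which is a realization of $y_\Sigma$. Two ALPVs $(r,m,n,\mathcal{P},\{(A_q,B_q,C_q)\})$ and $(r,m,n_a,\mathcal{P},\{(A_q^a,B_q^a,C_q^a)\})$ are isomorphic if $n_a=n$ and there is a nonsingular constant $\mathcal{S}\in\mathbb{R}^{n\times n}$ with $A_q^a\mathcal{S}=\mathcal{S}A_q$, $B_q^a=\mathcal{S}B_q$, $C_q^a\mathcal{S}=C_q$ for all $q\in Q$. *)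

(* Defs.v *)
(* MathComp / MathComp-Analysis *)
From HB Require Import structures.
From mathcomp Require Import all_boot all_order all_algebra.
From mathcomp Require Import boolp classical_sets reals.

Set Implicit Arguments.
Unset Strict Implicit.
Unset Printing Implicit Defensive.

Import Order.TTheory GRing.Theory Num.Theory.

Local Open Scope classical_set_scope.
Local Open Scope ring_scope.

(* The linear span of a possibly infinite set [X]: the vectors lying in the
   span <<s>> of some finite sequence [s] of elements of [X]. *)
Definition lin_span (K : fieldType) (V : vectType K) (X : set V) : set V :=
  [set v | exists s : seq V, [set` s] `<=` X /\ v \in <<s>>%VS].

(* [X]^+, in the exploded form used by [path]: the pair [(a, s)] stands for
   the non-empty sequence [a :: s], so that [last a s] is its last element and
   [belast a s] is the sequence with its last element removed. *)
Definition neseq (X : Type) : Type := (X * seq X)%type.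

(* The scheduling space [P] is not used by the fields; it determines the
   words over which the system is run. *)
Record alpv (R : realType) (D m r : nat) (P : set 'cV[R]_D) := Alpv {
  alpv_dim : nat;
  matA : 'I_D -> 'M[R]_alpv_dim;
  matB : 'I_D -> 'M[R]_(alpv_dim, m);
  matC : 'I_D -> 'M[R]_(r, alpv_dim)
}.

Definition input (R : realType) (D m : nat) (P : set 'cV[R]_D) : Type :=
  (set_type P * 'cV[R]_m)%type.

Section Alpv.
Variables (R : realType) (D m r : nat) (P : set 'cV[R]_D).
Implicit Types (S : alpv m r P) (a : input m P) (w : neseq (input m P)).

Definition next_state S (x : 'cV[R]_(alpv_dim S)) a : 'cV[R]_(alpv_dim S) :=
  \sum_(q < D) val a.1 q 0 *: (matA S q *m x + matB S q *m a.2).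

Definition readout S (x : 'cV[R]_(alpv_dim S)) (p : set_type P) : 'cV[R]_r :=
  \sum_(q < D) val p q 0 *: (matC S q *m x).

(* For w = (p(0),u(0)) ... (p(t),u(t)), this is x(t): the last letter
   (p(t),u(t)) does not act on the state, so a one-letter word gives x(0). *)
Definition state_map S (x : 'cV[R]_(alpv_dim S)) w : 'cV[R]_(alpv_dim S) :=
  foldl (@next_state S) x (belast w.1 w.2).

(* y(t), which depends on p(t) through the output equation. *)
Definition output_map S (x : 'cV[R]_(alpv_dim S)) w : 'cV[R]_r :=
  readout (state_map x w) (last w.1 w.2).1.

Definition io_map S : neseq (input m P) -> 'cV[R]_r := @output_map S 0.

Definition realization_of S (f : neseq (input m P) -> 'cV[R]_r) : Prop :=
  f = io_map S.

Definition io_equivalent S1 S2 : Prop := io_map S1 = io_map S2.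

Definition reachable S : Prop :=
  lin_span (range (@state_map S 0)) = setT.

Definition observable S : Prop :=
  forall x1 x2 : 'cV[R]_(alpv_dim S), output_map x1 = output_map x2 -> x1 = x2.

Definition minimal S : Prop :=
  forall S' : alpv m r P,
    realization_of S' (io_map S) -> (alpv_dim S <= alpv_dim S')%N.

(* The casts only transport the matrices of [Sa] along the equality [e]. *)
Definition isomorphic S (Sa : alpv m r P) : Prop :=
  exists (e : alpv_dim Sa = alpv_dim S) (T : 'M[R]_(alpv_dim S)),
    T \in unitmx /\
    forall q : 'I_D,
      [/\ castmx (e, e) (matA Sa q) *m T = T *m matA S q,
          castmx (e, erefl m) (matB Sa q) = T *m matB S q
        & castmx (erefl r, e) (matC Sa q) *m T = matC S q].

End Alpv.

(* Main.v *)
(* Write A_p, B_p, C_p for the p-combinations of the system matrices. Since P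
   spans, an identity linear in p that holds on P holds for each index q, so
   everything can be tested on scheduling values in P. If S is reachable and S'
   has the same input-output map, pick inputs whose states in S are the columns
   of a matrix R of full row rank, let R' collect the states of S' for the same
   inputs, and put T = R' R^+. The products of zero-input observability matrices
   and reached states are determined by the input-output map, so T carries the
   observability matrices of S' to those of S. If S is observable, T is injective,
   which bounds the dimension; if S' is observable too, T commutes with the dynamics.
   Conversely, restricting to the span of the reached states, or factoring out
   the unobservable vectors, gives a realization of the same map. *)
Require Import Defs.
From HB Require Import structures.
From mathcomp Require Import all_boot all_order all_algebra.
From mathcomp Require Import boolp classical_sets reals.

Local Open Scope classical_set_scope.
Local Open Scope ring_scope.

Set Implicit Arguments.
Unset Strict Implicit.
Unset Printing Implicit Defensive.

Import GRing.Theory.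

(** * Linear algebra: finite bases of families, and combinations linear in p *)

Lemma lin_span_ind (K : fieldType) (V : vectType K) (X : set V) (Q : V -> Prop) :
    Q 0 -> (forall a x y, Q x -> Q y -> Q (a *: x + y)) ->
    (forall x, X x -> Q x) ->
  forall x, lin_span X x -> Q x.
Proof.
move=> Q0 QD QX x [s [sX x_s]]; rewrite (coord_span (X := in_tuple s) x_s).
have QZ i : Q s`_i.
  have [i_s|s_i] := ltnP i (size s); last by rewrite nth_default.
  by apply/QX/sX; rewrite /= mem_nth.
elim/big_ind: _ => // [y z Qy Qz|i _]; first by rewrite -[y]scale1r; apply: QD.
by rewrite -[_ *: _]addr0; apply: QD.
Qed.

(** A free family that misses some [v x] stays free when [v x] is added; the rank is at most [n], so
    [d], a bound on [n - N], serves as fuel. *)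
Lemma exists_row_basis (F : fieldType) (K : Type) n (v : K -> 'rV[F]_n) :
  exists N (k : 'I_N -> K), row_free (\matrix_j v (k j)) /\
    forall x, (v x <= \matrix_j v (k j))%MS.
Proof.
suff H d N (k : 'I_N -> K) : (n - N <= d)%N -> row_free (\matrix_j v (k j)) ->
    exists N (k : 'I_N -> K), row_free (\matrix_j v (k j)) /\
    forall x, (v x <= \matrix_j v (k j))%MS.
  apply: (H n 0 (fun i : 'I_0 => False_rect K (notF (ltn_ord i)))).
    by rewrite subn0.
  by rewrite /row_free flatmx0 mxrank0.
elim: d N k => [|d IHd] N k le_nN free_k;
  have [span_k|] := pselect (forall x, (v x <= \matrix_j v (k j))%MS);
  try by exists N, k.
  case=> x; apply: submx_full; rewrite /row_full eqn_leq rank_leq_col.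
  by rewrite (eqP free_k) -subn_eq0 -leqn0.
move=> /existsNP[x /negP x_k].
pose k' (i : 'I_N.+1) := oapp k x (unlift ord0 i).
have lt_kk' : (\matrix_j v (k j) < \matrix_j v (k' j))%MS.
  rewrite ltmxE; apply/andP; split.
    apply/row_subP => i; rewrite rowK.
    have -> : v (k i) = row (lift ord0 i) (\matrix_j v (k' j)).
      by rewrite rowK /k' liftK.
    exact: row_sub.
  apply: contra x_k; apply: submx_trans.
  have -> : v x = row ord0 (\matrix_j v (k' j)) by rewrite rowK /k' unlift_none.
  exact: row_sub.
have free_k' : row_free (\matrix_j v (k' j)).
  rewrite /row_free eqn_leq rank_leq_row -[X in (X < _)%N](eqP free_k).
  exact: rank_ltmx lt_kk'.
have ltNn := rank_leq_col (\matrix_j v (k' j)); rewrite (eqP free_k') in ltNn.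
by apply: IHd free_k'; rewrite -ltnS subnSK.
Qed.

Definition cols_mx (F : fieldType) n N (v : 'I_N -> 'cV[F]_n) : 'M[F]_(n, N) :=
  \matrix_(i, j) v j i 0.

Lemma tr_cols_mx (F : fieldType) n N (v : 'I_N -> 'cV[F]_n) :
  (cols_mx v)^T = \matrix_j (v j)^T.
Proof. by apply/matrixP => i j; rewrite !mxE. Qed.

Lemma eq_mul_cols_mx (F : fieldType) a n n' N (M : 'M[F]_(a, n)) (M' : 'M_(a, n'))
    (v : 'I_N -> 'cV_n) (v' : 'I_N -> 'cV_n') :
  (forall j, M *m v j = M' *m v' j) -> M *m cols_mx v = M' *m cols_mx v'.
Proof.
move=> eqM; apply/matrixP => i j.
have /matrixP/(_ i 0) := eqM j; rewrite !mxE => eqMij.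
by under eq_bigr do rewrite mxE; rewrite eqMij; apply: eq_bigr => l _; rewrite mxE.
Qed.

Lemma exists_belast_last T (s : seq T) (a : T) :
  exists w : T * seq T, belast w.1 w.2 = s /\ last w.1 w.2 = a.
Proof.
case: s => [|b s]; first by exists (a, [::]).
by exists (b, rcons s a); rewrite /= belast_rcons last_rcons.
Qed.

Definition lincomb (R : fieldType) D a b (p : 'cV[R]_D) (M : 'I_D -> 'M[R]_(a, b)) :=
  \sum_(q < D) p q 0 *: M q.

Lemma lincomb_mull (R : fieldType) D a b c (p : 'cV[R]_D)
    (M : 'I_D -> 'M[R]_(a, b)) (N : 'M_(c, a)) :
  N *m lincomb p M = lincomb p (fun q => N *m M q).
Proof. by rewrite mulmx_sumr; apply: eq_bigr => q _; rewrite scalemxAr. Qed.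

Lemma lincomb_mulr (R : fieldType) D a b c (p : 'cV[R]_D)
    (M : 'I_D -> 'M[R]_(a, b)) (N : 'M_(b, c)) :
  lincomb p M *m N = lincomb p (fun q => M q *m N).
Proof. by rewrite mulmx_suml; apply: eq_bigr => q _; rewrite scalemxAl. Qed.

Lemma tr_lincomb (R : fieldType) D a b (p : 'cV[R]_D) (M : 'I_D -> 'M[R]_(a, b)) :
  (lincomb p M)^T = lincomb p (fun q => (M q)^T).
Proof. by rewrite /lincomb linear_sum; apply: eq_bigr => q _; rewrite linearZ. Qed.

(** Agreement is a linear condition on [p], so it passes from [P] to its span, hence to the basis
    vector [e], which selects the matrix of index [q]. *)
Lemma eq_lincomb (R : fieldType) D a b (P : set 'cV[R]_D) (hP : lin_span P = setT)
    (M N : 'I_D -> 'M[R]_(a, b)) :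
  (forall p, P p -> lincomb p M = lincomb p N) -> forall q, M q = N q.
Proof.
move=> eqMN q; pose e : 'cV[R]_D := delta_mx q 0.
have lincomb_e (L : 'I_D -> 'M[R]_(a, b)) : lincomb e L = L q.
  rewrite /lincomb (bigD1 q) //= mxE !eqxx scale1r big1 ?addr0 // => j /negPf jq.
  by rewrite mxE jq scale0r.
rewrite -[M q]lincomb_e -[N q]lincomb_e.
have : lin_span P e by rewrite hP.
apply: (lin_span_ind (Q := fun p => lincomb p M = lincomb p N)) => //
  [|c x y eqx eqy].
  by rewrite /lincomb !big1 // => j _; rewrite mxE scale0r.
have lin L : lincomb (c *: x + y) L = c *: lincomb x L + lincomb y L :> 'M_(a, b).
  rewrite /lincomb scaler_sumr -big_split; apply: eq_bigr => j _ /=.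
  by rewrite !mxE scalerDl scalerA.
by rewrite !lin eqx eqy.
Qed.

(** * Runs, zero-input observability matrices and reached states *)

Section Alpv.
Variables (R : realType) (D m r : nat) (P : set 'cV[R]_D).
Implicit Types S : alpv m r P.

(** Unlike [state_map], every letter acts and the empty sequence is allowed. *)
Definition run S (x : 'cV[R]_(alpv_dim S)) (s : seq (input m P)) :=
  foldl (@next_state R D m r P S) x s.

(** The head of [t] acts first, so its matrix is the rightmost factor. *)
Definition trans S (t : seq (set_type P)) : 'M[R]_(alpv_dim S) :=
  foldr (fun p M => M *m lincomb (val p) (matA S)) 1%:M t.

Definition obs_mx S (t : seq (set_type P)) (p : set_type P) :
    'M[R]_(r, alpv_dim S) :=
  lincomb (val p) (matC S) *m trans S t.

Lemma next_stateE S x (a : input m P) :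
  next_state x a =
    lincomb (val a.1) (matA S) *m x + lincomb (val a.1) (matB S) *m a.2.
Proof.
rewrite !lincomb_mulr -big_split; apply: eq_bigr => q _ /=.
by rewrite scalerDr.
Qed.

Lemma readoutE S x (p : set_type P) : readout x p = lincomb (val p) (matC S) *m x.
Proof. by rewrite lincomb_mulr. Qed.

Lemma run_affine S x (s : seq (input m P)) :
  run x s = trans S (unzip1 s) *m x + run 0 s.
Proof.
elim: s x => [|a s IHs] x /=; first by rewrite mul1mx addr0.
rewrite IHs [X in _ = _ + X]IHs !next_stateE mulmx0 add0r mulmxDr addrA.
by rewrite mulmxA.
Qed.

Definition quiet (t : seq (set_type P)) : seq (input m P) := [seq (p, 0) | p <- t].

Lemma unzip1_quiet t : unzip1 (quiet t) = t.
Proof. by rewrite /unzip1 /quiet -map_comp map_id. Qed.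

Lemma run0_single S p u :
  run (0 : 'cV_(alpv_dim S)) [:: (p, u)] = lincomb (val p) (matB S) *m u.
Proof. by rewrite /= next_stateE mulmx0 add0r. Qed.

Lemma run0_rcons S s p :
  run (0 : 'cV_(alpv_dim S)) (rcons s (p, 0)) =
    lincomb (val p) (matA S) *m run 0 s.
Proof. by rewrite /run foldl_rcons next_stateE mulmx0 addr0. Qed.

Lemma obs_mx_cons S p t q :
  obs_mx S (p :: t) q = obs_mx S t q *m lincomb (val p) (matA S).
Proof. by rewrite /obs_mx /= mulmxA. Qed.

Lemma output_mapP S1 S2 (x1 : 'cV_(alpv_dim S1)) (x2 : 'cV_(alpv_dim S2)) :
  output_map x1 = output_map x2 <->
  forall s (p : set_type P),
    lincomb (val p) (matC S1) *m run x1 s = lincomb (val p) (matC S2) *m run x2 s.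
Proof.
split=> [eq_out s p|eq_out]; last first.
  by apply/funext => w; rewrite /output_map !readoutE eq_out.
have [w [ws wp]] := exists_belast_last s (p, 0 : 'cV_m).
by have /(congr1 (@^~ w)) := eq_out; rewrite /output_map !readoutE /state_map ws wp.
Qed.

(** After [s], a zero-input word [quiet t] acts on the state by [trans S t], up to a term
    independent of [s]. The right-hand side consists of outputs from state 0. *)
Lemma obs_mx_run S t p s :
  obs_mx S t p *m run 0 s = lincomb (val p) (matC S) *m run 0 (s ++ quiet t) -
                            lincomb (val p) (matC S) *m run 0 (quiet t).
Proof.
rewrite [run 0 (s ++ _)]foldl_cat [foldl _ _ (quiet t)]run_affine unzip1_quiet.
by rewrite mulmxDr addrK mulmxA.
Qed.

(** Runs are affine in the initial state with a constant term that depends only on the input, so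
    this term cancels when two initial states are compared. *)
Lemma observableP S :
  observable S <->
  forall x : 'cV_(alpv_dim S), (forall t p, obs_mx S t p *m x = 0) -> x = 0.
Proof.
split=> [obsS x obs_x|ker0 x1 x2 /output_mapP eq_out].
  apply/obsS/output_mapP => s p.
  by rewrite run_affine mulmxDr mulmxA -/(obs_mx S _ _) obs_x add0r.
apply/eqP; rewrite -subr_eq0; apply/eqP/ker0 => t p.
have := eq_out (quiet t) p.
rewrite run_affine [X in _ = _ *m X]run_affine !mulmxDr => /addIr.
by rewrite unzip1_quiet !mulmxA mulmxN => eqO; rewrite /obs_mx eqO subrr.
Qed.

Lemma obs_mx_cancel S a (M N : 'M_(alpv_dim S, a)) :
  observable S -> (forall t p, obs_mx S t p *m M = obs_mx S t p *m N) -> M = N.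
Proof.
move=> /observableP ker0 eqMN; apply/trmx_inj/row_matrixP => j; rewrite -!tr_col.
congr trmx; apply/eqP.
rewrite -subr_eq0; apply/eqP/ker0 => t p.
by rewrite !colE -mulmxBl mulmxA mulmxBr eqMN subrr mul0mx.
Qed.

Lemma reachable_full S N (k : 'I_N -> seq (input m P)) (p0 : set_type P) :
  row_full (\matrix_j (run (0 : 'cV_(alpv_dim S)) (k j))^T) -> reachable S.
Proof.
move=> /row_fullP[G GE]; apply/seteqP; split=> // x _.
exists [seq run 0 (k j) | j <- enum 'I_N]; split.
  move=> _ /= /mapP[j _ ->].
  (* The last letter of a word does not act on the state, so any letter over [p0] may complete
     [k j]. *)
  have [w [ws _]] := exists_belast_last (k j) (p0, 0 : 'cV_m).
  by exists w => //; rewrite /state_map ws.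
rewrite -[x]trmxK -[x^T]mulmx1 -GE mulmxA mulmx_sum_row raddf_sum.
apply: memv_suml => j _; rewrite rowK /= linearZ /= trmxK.
by apply/memvZ/memv_span/map_f; rewrite mem_enum.
Qed.

Lemma reachable_cols S : reachable S ->
  exists N (k : 'I_N -> seq (input m P)) (G : 'M_(N, alpv_dim S)),
    cols_mx (fun j => run (0 : 'cV_(alpv_dim S)) (k j)) *m G = 1%:M.
Proof.
move=> reachS.
have [N [k [_ span_k]]] :=
  exists_row_basis (fun s => (run (0 : 'cV_(alpv_dim S)) s)^T).
have /row_fullP[G GE] : row_full (\matrix_j (run (0 : 'cV_(alpv_dim S)) (k j))^T).
  rewrite -sub1mx; apply/row_subP => i; rewrite rowE mulmx1.
  have : lin_span (range (@state_map R D m r P S 0)) (delta_mx i 0) by rewrite reachS.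
  rewrite -[delta_mx 0 i]trmx_delta.
  apply: (lin_span_ind (Q := fun x => (x^T <= _)%MS)) => [|c x y xk yk|_ [w _ <-]].
  - by rewrite trmx0 sub0mx.
  - by rewrite linearP; apply/addmx_sub/yk/scalemx_sub.
  - exact: span_k.
exists N, k, G^T; apply: trmx_inj.
by rewrite trmx_mul trmxK tr_cols_mx GE trmx1.
Qed.

(** * Comparing two systems with the same input-output map *)

Lemma io_hankel S S' : io_equivalent S S' -> forall t p s,
  obs_mx S t p *m run 0 s = obs_mx S' t p *m run 0 s.
Proof. by move=> /output_mapP eqSS' t p s; rewrite !obs_mx_run !eqSS'. Qed.

Lemma obs_intertwiner S S' : reachable S -> io_equivalent S S' ->
  exists T : 'M_(alpv_dim S', alpv_dim S),
    forall t p, obs_mx S' t p *m T = obs_mx S t p.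
Proof.
move=> /reachable_cols[N [k [G RG]]] /io_hankel eqH.
(* These are the runs of [S'] on the inputs whose states in [S] form a matrix with right inverse
   [G]. *)
exists (cols_mx (fun j => run 0 (k j)) *m G) => t p.
rewrite mulmxA -[RHS]mulmx1 -RG [RHS]mulmxA; congr (_ *m _).
by apply: eq_mul_cols_mx => j; rewrite eqH.
Qed.

(** A vector killed by [T] is killed by every observability matrix of [S]. The transpose turns
    injectivity on columns into [row_free]. *)
Lemma obs_intertwiner_free S S' (T : 'M_(alpv_dim S', alpv_dim S)) : observable S ->
  (forall t p, obs_mx S' t p *m T = obs_mx S t p) -> row_free T^T.
Proof.
move=> obsS TO; rewrite -kermx_eq0 -trmx_eq0; apply/eqP.
apply: (obs_mx_cancel obsS) => t p; rewrite mulmx0 -TO -mulmxA.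
by rewrite -[T]trmxK -trmx_mul trmxK mulmx_ker trmx0 mulmx0.
Qed.

Lemma reachable_observable_minimal S : reachable S -> observable S -> minimal S.
Proof.
move=> reachS obsS S' eqSS'.
have [T /(obs_intertwiner_free obsS) /eqP <-] := obs_intertwiner reachS eqSS'.
exact: rank_leq_col.
Qed.

(** [T] may be any rectangular matrix: it serves below both as the inclusion of the reached subspace
    and as a quotient map. *)
Lemma io_map_morphism S S' (T : 'M_(alpv_dim S', alpv_dim S)) :
    (forall q, matA S' q *m T = T *m matA S q) ->
    (forall q, matB S' q = T *m matB S q) ->
    (forall q, matC S' q *m T = matC S q) ->
  io_map S = io_map S'.
Proof.
move=> TA TB TC; apply/output_mapP => s p.
suff -> : run 0 s = T *m run 0 s.
  rewrite mulmxA [lincomb _ _ *m T]lincomb_mulr; congr (_ *m _).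
  by apply: eq_bigr => q _; rewrite TC.
elim/last_ind: s => [|s a IHs]; first by rewrite mulmx0.
rewrite [in LHS]/run [in RHS]/run !foldl_rcons -/(run _ _) -/(run _ _) IHs.
rewrite !next_stateE mulmxDr !mulmxA.
rewrite [_ *m T]lincomb_mulr !lincomb_mull; congr (_ + _); congr (_ *m _);
  apply: eq_bigr => q _.
  by rewrite TA.
by rewrite TB.
Qed.

(** * Reduction of minimal systems, and isomorphism *)

Section Spanning.
Hypothesis hP : lin_span P = setT.

Lemma eq_lincomb_in a b (M N : 'I_D -> 'M[R]_(a, b)) :
  (forall p : set_type P, lincomb (val p) M = lincomb (val p) N) ->
  forall q, M q = N q.
Proof.
move=> eqMN; apply: (eq_lincomb hP) => p Pp.
exact: (eqMN (SigSub (mem_set Pp))).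
Qed.

Lemma submx_lincomb a b N (E : 'M[R]_(N, b)) (M : 'I_D -> 'M_(a, b)) :
  (forall p : set_type P, (lincomb (val p) M <= E)%MS) ->
  forall q, (M q <= E)%MS.
Proof.
move=> ME q; rewrite submxE; apply/eqP.
apply: (eq_lincomb_in (M := fun q => M q *m _) (N := fun=> 0)) => p.
rewrite -lincomb_mulr [RHS]big1 => [|j _]; last by rewrite scaler0.
by apply/eqP; rewrite -submxE.
Qed.

Lemma minimal_reachable S (p0 : set_type P) : minimal S -> reachable S.
Proof.
move=> minS.
have [N [k [free_k span_k]]] :=
  exists_row_basis (fun s => (run (0 : 'cV_(alpv_dim S)) s)^T).
set E := (\matrix_j _) in free_k span_k.
have EA : forall q, (E *m (matA S q)^T <= E)%MS.
  apply: submx_lincomb => p; rewrite -lincomb_mull -tr_lincomb.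
  apply/row_subP => j; rewrite row_mul rowK.
  by rewrite -trmx_mul -run0_rcons.
have EB : forall q, ((matB S q)^T <= E)%MS.
  apply: submx_lincomb => p; rewrite -tr_lincomb.
  by apply/row_subP => j; rewrite -tr_col colE -run0_single.
(* [E^T] embeds the reached subspace; on row vectors in the row space of [E], [pinvmx E] gives
   coordinates along the rows of [E]. *)
pose S' : alpv m r P :=
  Alpv P (fun q => (E *m (matA S q)^T *m pinvmx E)^T)
         (fun q => ((matB S q)^T *m pinvmx E)^T) (fun q => matC S q *m E^T).
have eqS'S : io_map S' = io_map S.
  apply: (@io_map_morphism S' S E^T) => q //=; apply: trmx_inj.
    by rewrite !trmx_mul !trmxK mulmxKpV.
  by rewrite trmx_mul !trmxK mulmxKpV.
(* Minimality forces the [N] free rows of [E] to fill the whole space. *)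
have leSN : (alpv_dim S <= N)%N by exact: (minS S' (esym eqS'S)).
apply: (reachable_full (k := k) p0).
by rewrite /row_full eqn_leq rank_leq_col (eqP free_k).
Qed.

Lemma minimal_observable S : minimal S -> observable S.
Proof.
move=> minS.
have [N [k [free_k span_k]]] := exists_row_basis
  (fun x : seq (set_type P) * set_type P * 'I_r => row x.2 (obs_mx S x.1.1 x.1.2)).
set E := (\matrix_j _) in free_k span_k.
have EA : forall q, (E *m matA S q <= E)%MS.
  apply: submx_lincomb => p; rewrite -lincomb_mull.
  apply/row_subP => j; rewrite row_mul rowK -row_mul -obs_mx_cons.
  exact: (span_k (_, _, _)).
have EC : forall q, (matC S q <= E)%MS.
  apply: submx_lincomb => p; apply/row_subP => j.
  by have := span_k ([::], p, j); rewrite /obs_mx mulmx1.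
(* The kernel of [E] is the unobservable subspace and [E] is the quotient map; [EA] and [EC] let the
   dynamics and the output factor through it. *)
pose S' : alpv m r P :=
  Alpv P (fun q => E *m matA S q *m pinvmx E)
         (fun q => E *m matB S q) (fun q => matC S q *m pinvmx E).
have eqSS' : io_map S = io_map S'.
  by apply: (@io_map_morphism S S' E) => q //=; rewrite mulmxKpV.
have leSN : (alpv_dim S <= N)%N by exact: (minS S' eqSS').
have full_E : row_full E by rewrite /row_full eqn_leq rank_leq_col (eqP free_k).
apply/observableP => x obs_x; apply: (row_full_inj full_E); rewrite mulmx0.
apply/row_matrixP => j; rewrite row_mul rowK -row_mul obs_x.
by rewrite !row0.
Qed.

Lemma intertwiner_morphism S S' (T : 'M_(alpv_dim S', alpv_dim S)) :
    reachable S -> observable S' -> io_equivalent S S' ->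
    (forall t p, obs_mx S' t p *m T = obs_mx S t p) ->
  [/\ forall q, matA S' q *m T = T *m matA S q,
      forall q, matB S' q = T *m matB S q &
      forall q, matC S' q *m T = matC S q].
Proof.
move=> reachS obsS' /io_hankel eqH TO.
(* [T] sends reached states to reached states, as the observability matrices of [S'] cannot tell the
   two sides apart. *)
have Trun s : T *m run 0 s = run 0 s.
  by apply: (obs_mx_cancel obsS') => t p; rewrite mulmxA TO eqH.
split; apply: eq_lincomb_in => p.
(* Both sides, seen through [obs_mx S' t p'], become [obs_mx S (p :: t) p']. *)
- rewrite -lincomb_mulr -lincomb_mull; apply: (obs_mx_cancel obsS') => t p'.
  by rewrite !mulmxA -obs_mx_cons !TO obs_mx_cons.
(* Column [j] is the state reached by one letter whose input is the j-th basis vector. *)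
- rewrite -lincomb_mull; apply/trmx_inj/row_matrixP => j.
  by rewrite -!tr_col !colE -mulmxA -!run0_single Trun.
- rewrite -lincomb_mulr.
  by have := TO [::] p; rewrite /obs_mx !mulmx1.
Qed.

End Spanning.

Lemma isomorphicP S S' (T : 'M_(alpv_dim S', alpv_dim S)) :
    alpv_dim S' = alpv_dim S -> row_free T^T ->
    (forall q, matA S' q *m T = T *m matA S q) ->
    (forall q, matB S' q = T *m matB S q) ->
    (forall q, matC S' q *m T = matC S q) ->
  isomorphic S S'.
Proof.
(* With the records opened, the dimensions are variables that can be identified, and the casts
   become trivial. *)
case: S T => n A B C; case: S' => n' A' B' C' /= T eqn; subst n'.
rewrite row_free_unit unitmx_tr => unitT TA TB TC.
by exists erefl, T; split=> // q; rewrite !castmx_id.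
Qed.

End Alpv.

Theorem theorem2 (R : realType) (D m r : nat)
    (hD : (0 < D)%N) (hm : (0 < m)%N) (hr : (0 < r)%N)
    (P : set 'cV[R]_D) (hP : lin_span P = setT) :
  (forall S : alpv m r P, minimal S <-> reachable S /\ observable S) /\
  (forall S1 S2 : alpv m r P,
     minimal S1 -> minimal S2 -> io_equivalent S1 S2 -> isomorphic S1 S2).
Proof.
(* If [P] were empty, [eq_lincomb] would hold vacuously and, as [D > 0], identify the constant
   families 1 and 0. *)
have [p Pp] : P !=set0.
  apply: contrapT => noP.
  suff: (1 : 'M[R]_1) = 0 by apply/eqP/oner_neq0.
  apply: (eq_lincomb hP (M := fun=> 1) (N := fun=> 0) _ (Ordinal hD)) => p Pp.
  by case: noP; exists p.
have minP (S : alpv m r P) : minimal S <-> reachable S /\ observable S.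
  split=> [minS|[]]; last exact: reachable_observable_minimal.
  by split; [apply: (minimal_reachable hP (SigSub (mem_set Pp)))|
             apply: minimal_observable].
split=> // S1 S2 min1 min2 eq12.
have [[reach1 obs1] [_ obs2]] := ((minP S1).1 min1, (minP S2).1 min2).
have [T TO] := obs_intertwiner reach1 eq12.
have [TA TB TC] := intertwiner_morphism hP reach1 obs2 eq12 TO.
apply: (isomorphicP (T := T)) => //; last exact: obs_intertwiner_free TO.
apply/eqP; rewrite eqn_leq (min2 S1 (esym eq12)).
exact: (min1 S2 eq12).
Qed.
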